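(* Let $h\in\mathbb{F}[x]$ with $\deg h\ge1$, and suppose $h$ has exactly $k\ge1$ distinct roots in an algebraic closure $\overline{\mathbb{F}}$. Case $k=1$: let $\lambda$ be the unique root of $h$ in $\overline{\mathbb{F}}$. (a) If $\lambda\in\mathbb{F}$, then $\mathbb{P}=\{(\alpha,(1-\alpha)\lambda):\alpha\in\mathbb{F}^*\}$, $\tau_{\mathbb{P}}\cong\mathbb{F}^*$ via $\tau_{\alpha,(1-\alpha)\lambda}\mapsto\alpha$, and $\mathrm{Aut}_{\mathbb{F}}(A_h)=\{\phi_f\}\rtimes\tau_{\mathbb{P}}\cong\mathbb{F}[x]\rtimes\mathbb{F}^*$, where for all $f\in\mathbb{F}[x]$, $\alpha\in\mathbb{F}^*$: $\tau_{\alpha,(1-\alpha)\lambda}^{-1}\circ\phi_f\circ\tau_{\alpha,(1-\alpha)\lambda}=\phi_g$ with $g(x)=\alpha^{\deg h-1}f(\alpha^{-1}x-(\alpha^{-1}-1)\lambda)$. (b) If $\lambda\notin\mathbb{F}$, then $\mathrm{Aut}_{\mathbb{F}}(A_h)=\{\phi_f:f\in\mathbb{F}[x]\}\cong\mathbb{F}[x]$. Case $k\ge2$: the group $\tau_{\mathbb{P}}/\tau_{1,\mathbb{G}}$ is a finite cyclic group. If $\tau_{\mathbb{P}}\ne\tau_{1,\mathbb{G}}$, then $\tau_{\mathbb{P}}=\tau_{1,\mathbb{G}}\rtimes\langle\tau_{\alpha,\beta}\rangle$ for some $(\alpha,\beta)\in\mathbb{P}$ with $\alpha\ne1$ and either $\alpha^{k-1}=1$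 or $\alpha^k=1$; moreover $\tau_{\alpha,\beta}^{-1}\circ\tau_{1,\nu}\circ\tau_{\alpha,\beta}=\tau_{1,\alpha\nu}$ for all $\nu\in\mathbb{G}$, and $\mathrm{Aut}_{\mathbb{F}}(A_h)\cong N\rtimes\langle\tau_{\alpha,\beta}\rangle$ where $N=\{\phi_f:f\in\mathbb{F}[x]\}\rtimes\tau_{1,\mathbb{G}}$.
   Context: $\mathbb{F}$ is an arbitrary field. For $h\in\mathbb{F}[x]$, $A_h$ is the unital associative $\mathbb{F}$-algebra generated by $x,\hat y$ with defining relation $\hat yx-x\hat y=h$. Let $\mathbb{P}=\{(\alpha,\beta)\in\mathbb{F}^*\times\mathbb{F}: h(\alpha x+\beta)=\alpha^{\deg h}h(x)\}$. For $(\alpha,\beta)\in\mathbb{P}$, $\tau_{\alpha,\beta}$ is the automorphism of $A_h$ with $\tau_{\alpha,\beta}(x)=\alpha x+\beta$, $\tau_{\alpha,\beta}(\hat y)=\alpha^{\deg h-1}\hat y$; $\tau_{\mathbb{P}}=\{\tau_{\alpha,\beta}:(\alpha,\beta)\in\mathbb{P}\}$ is a group. For $f\in\mathbb{F}[x]$, $\phi_f$ is the automorphism with $\phi_f(x)=x$, $\phi_f(\hat y)=\hat y+f$. $\mathbb{G}=\{\nu\in\mathbb{F}:(1,\nu)\in\mathbb{P}\}$ (a finite additive subgroup of $\mathbb{F}$, trivial in characteristic $0$) and $\tau_{1,\mathbb{G}}=\{\tau_{1,\nu}:\nu\in\mathbb{G}\}$, a normal subgroup of $\tau_{\mathbb{P}}$.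 *)

(* Defs.v *)
From HB Require Import structures.
From mathcomp Require Import all_boot all_order all_algebra.
Set Implicit Arguments. Unset Strict Implicit. Unset Printing Implicit Defensive.
Import GRing.Theory.
Local Open Scope ring_scope.

(* The algebra A_h, realized through its PBW normal form.                   *)
(* An element  sum_j p_j(x) yhat^j  (coefficients on the left) is stored as *)
(* a polynomial in the (outer) variable yhat with coefficients p_j in F[x], *)
(* i.e. an element of {poly {poly F}}.  The defining relation               *)
(*   yhat * p = p * yhat + h * p'   (p in F[x])                             *)
(* gives  yhat^i p = sum_k C(i,k) delta^k(p) yhat^(i-k),  delta = h d/dx,   *)
(* whence the multiplication below (Ore extension F[x][yhat; delta]).       *)
Section Ah.
Variable F : fieldType.
Implicit Types (h f g p : {poly F}) (a b X Y : {poly {poly F}}).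

Definition Adelta h p : {poly F} := h * p^`().

Definition Amul h a b : {poly {poly F}} :=
  \sum_(i < size a) \sum_(j < size b) \sum_(k < i.+1)
     (('C(i, k))%:R * a`_i * iter k (Adelta h) b`_j) *: 'X^(i + j - k).

Definition Aexp h a (n : nat) : {poly {poly F}} := iter n (Amul h a) 1.

Definition Ax : {poly {poly F}} := ('X : {poly F})%:P.
Definition Ay : {poly {poly F}} := 'X.

Definition Apeval h p X : {poly {poly F}} :=
  \sum_(i < size p) (p`_i)%:P *: Aexp h X i.

(* the F-algebra endomorphism of A_h determined by x |-> X, yhat |-> Y      *)
(* (evaluated on the normal form sum_j p_j(x) yhat^j)                       *)
Definition Aev h X Y a : {poly {poly F}} :=
  \sum_(j < size a) Amul h (Apeval h a`_j X) (Aexp h Y j).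

Definition is_Aut h (s : {poly {poly F}} -> {poly {poly F}}) : Prop :=
  [/\ bijective s,
      forall a b, s (a + b) = s a + s b,
      forall (c : F) a, s (c%:P%:P * a) = c%:P%:P * s a,
      s 1 = 1 &
      forall a b, s (Amul h a b) = Amul h (s a) (s b)].

Definition degh h : nat := (size h).-1.

Definition inP h (al be : F) : bool :=
  (al != 0) && (h \Po (al%:P * 'X + be%:P) == al ^+ degh h *: h).

Definition inG h (nu : F) : bool := inP h 1 nu.

Definition tau h (al be : F) : {poly {poly F}} -> {poly {poly F}} :=
  Aev h (al%:P * 'X + be%:P)%:P ((al ^+ (degh h).-1)%:P *: Ay).

Definition phi h f : {poly {poly F}} -> {poly {poly F}} :=
  Aev h Ax (Ay + f%:P).

End Ah.

Definition fpow (T : Type) (g : T -> T) (i : nat) : T -> T := iter i (fun s => g \o s) id.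

Definition in_cyc (T : Type) (g s : T -> T) : Prop :=
  exists i : nat, s =1 fpow g i \/ s \o fpow g i =1 id.

Section Cases.
Variable F : fieldType.
Implicit Types (h f g : {poly F}).

Definition case_a h (l : F) : Prop :=
  [/\
      forall al be, inP h al be <-> (al != 0 /\ be = (1 - al) * l),
      (* tau_P ~= F^* via tau_{alpha,(1-alpha)lambda} |-> alpha:
         homomorphism ... *)
      (forall al al', al != 0 -> al' != 0 ->
        tau h al ((1 - al) * l) \o tau h al' ((1 - al') * l)
          =1 tau h (al * al') ((1 - al * al') * l))
      /\ (* ... and well defined bijection *)
      (forall al al', al != 0 -> al' != 0 ->
        tau h al ((1 - al) * l) =1 tau h al' ((1 - al') * l) -> al = al'),
      (forall s, is_Aut h s <->
         exists f (al : F), al != 0 /\ s =1 phi h f \o tau h al ((1 - al) * l))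
      /\ (forall f f' al al', al != 0 -> al' != 0 ->
         phi h f \o tau h al ((1 - al) * l) =1 phi h f' \o tau h al' ((1 - al') * l) ->
         f = f' /\ al = al'),
      forall f g, phi h f \o phi h g =1 phi h (f + g) &
      forall f (al : F), al != 0 ->
        phi h f \o tau h al ((1 - al) * l) =1
        tau h al ((1 - al) * l) \o
          phi h ((al ^+ (degh h).-1) *: (f \Po ((al^-1)%:P * 'X - ((al^-1 - 1) * l)%:P)))].

Definition case_b h : Prop :=
  [/\ forall s, is_Aut h s <-> exists f, s =1 phi h f,
      forall f f', phi h f =1 phi h f' -> f = f' &
      forall f g, phi h f \o phi h g =1 phi h (f + g)].

Definition tauP_ne_tauG h : Prop :=
  exists al be, inP h al be /\ ~ (exists nu, inG h nu /\ tau h al be =1 tau h 1 nu).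

Definition case_k h (k : nat) : Prop :=
  (* tau_P / tau_{1,G} is a finite cyclic group *)
  (exists (n : nat) (ga gb : F),
     [/\ (0 < n)%N, inP h ga gb,
         exists nu, inG h nu /\ fpow (tau h ga gb) n =1 tau h 1 nu &
         forall al be, inP h al be -> exists nu (i : nat),
           [/\ inG h nu, (i < n)%N & tau h al be =1 tau h 1 nu \o fpow (tau h ga gb) i]])
  /\
  (tauP_ne_tauG h ->
   exists al be,
   [/\ inP h al be, al != 1, al ^+ k.-1 = 1 \/ al ^+ k = 1,
       (* tau_P = tau_{1,G} x| <tau_{al,be}> *)
       ((forall al' be', inP h al' be' -> exists nu c,
           [/\ inG h nu, in_cyc (tau h al be) c & tau h al' be' =1 tau h 1 nu \o c])
       /\ (forall nu c, inG h nu -> in_cyc (tau h al be) c -> tau h 1 nu =1 c -> c =1 id))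
       /\
       (forall nu, inG h nu -> tau h 1 nu \o tau h al be =1 tau h al be \o tau h 1 (al * nu)) &
       (* Aut(A_h) = N x| <tau_{al,be}>,  N = {phi_f} x| tau_{1,G} *)
       [/\ forall s, is_Aut h s <-> exists f nu c,
              [/\ inG h nu, in_cyc (tau h al be) c & s =1 phi h f \o tau h 1 nu \o c],
           (* N normal in Aut(A_h) *)
           forall f nu, inG h nu -> exists f' nu', inG h nu' /\
              phi h f \o tau h 1 nu \o tau h al be =1 tau h al be \o phi h f' \o tau h 1 nu',
           forall f nu c, inG h nu -> in_cyc (tau h al be) c ->
              phi h f \o tau h 1 nu =1 c -> c =1 id,
           (* {phi_f} normal in N *)
           forall f nu, inG h nu -> exists f',
              phi h f \o tau h 1 nu =1 tau h 1 nu \o phi h f' &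
           forall f nu, inG h nu -> phi h f =1 tau h 1 nu -> phi h f =1 id]]).

End Cases.

(* Main.v *)
Require Import Defs.
From Stdlib Require Import Classical_Prop.
From HB Require Import structures.
From mathcomp Require Import all_boot all_order all_algebra cyclic.
Set Implicit Arguments. Unset Strict Implicit. Unset Printing Implicit Defensive.
Import GRing.Theory.
Local Open Scope ring_scope.

(* Write [deg] for the degree in yhat; it is additive on products.

   Automorphisms.  Modulo [h] the algebra is commutative, so every commutator
   lies in [h A_h], and [h = yhat x - x yhat] is itself a commutator.  Hence an
   automorphism [s] maps [h] to [c h] with [c] a unit, i.e. a scalar.  From
   [h (s x) = c h] and additivity of [deg] we get [deg (s x) = 0]; the same for
   the inverse of [s] makes [s x = al x + be] affine, with [(al, be)] in P.  As
   yhat is in the image of [s], [deg (s yhat) = 1], and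
   [s yhat * s x - s x * s yhat = s h] leaves only
   [s yhat = al ^ (deg_x h - 1) yhat + r (x)], so [s = phi_f o tau_(al, be)].

   The group P.  If [(al, be)] is in P then [z |-> al z + be] permutes the roots
   of [h].  With one root [lam] this says [be = (1 - al) lam].  With [k >= 2]
   roots, two of them determine [al], so the [al] form a finite, hence cyclic,
   subgroup of F^*.  If [al <> 1], then [mu = be / (1 - al)] is fixed, the powers of
   the map are [z |-> mu + al ^ i (z - mu)], and [al] permutes the nonzero
   [z - mu] with [z] a root: comparing products, [al ^ k = 1] or
   [al ^ (k - 1) = 1]. *)

(** * The algebra *)

Section Ore.
Variables (F : fieldType) (h : {poly F}).
Implicit Types (p q : {poly F}) (a b : {poly {poly F}}).

Lemma Adelta_is_zmod_morphism : zmod_morphism (Adelta h).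
Proof. by move=> p q; rewrite /Adelta derivB mulrBr. Qed.
HB.instance Definition _ :=
  GRing.isZmodMorphism.Build _ _ (Adelta h) Adelta_is_zmod_morphism.

Lemma AdeltaM p q : Adelta h (p * q) = Adelta h p * q + p * Adelta h q.
Proof. by rewrite /Adelta derivM mulrDr mulrA mulrCA. Qed.

Lemma AdeltaC (c : F) : Adelta h c%:P = 0.
Proof. by rewrite /Adelta derivC mulr0. Qed.

Lemma AdeltaZn n p : Adelta h (n%:R * p) = n%:R * Adelta h p.
Proof. by rewrite !mulr_natl raddfMn. Qed.

(** Left multiplication by yhat on normal forms: [yhat p yhat^j] is
    [p yhat^(j+1) + delta(p) yhat^j]. *)
Definition Ly a : {poly {poly F}} := 'X * a + map_poly (Adelta h) a.

Lemma Ly_is_zmod_morphism : zmod_morphism Ly.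
Proof. by move=> a b; rewrite /Ly raddfB mulrBr opprD addrACA. Qed.
HB.instance Definition _ := GRing.isZmodMorphism.Build _ _ Ly Ly_is_zmod_morphism.

Lemma LyZ p a : Ly (p *: a) = p *: Ly a + Adelta h p *: a.
Proof.
rewrite /Ly -scalerAr scalerDr -addrA; congr (_ + _).
by apply/polyP=> i; rewrite !(coefD, coefZ, coef_map) /= AdeltaM addrC.
Qed.

Lemma Ly_Xn n : Ly 'X^n = 'X^(n.+1).
Proof.
rewrite /Ly exprS -[RHS]addr0; congr (_ + _); apply/polyP=> i.
by rewrite coef_map coefXn coef0 /= -(rmorph_nat polyC) AdeltaC.
Qed.

Lemma iter_LyB i : zmod_morphism (iter i Ly).
Proof. by elim: i => [|i IHi] a b //=; rewrite IHi raddfB. Qed.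
HB.instance Definition _ i :=
  GRing.isZmodMorphism.Build _ _ (iter i Ly) (iter_LyB i).

(** Leibniz rule for [delta]; it identifies the inner sum of [Amul] with repeated multiplication by
    yhat. *)
Lemma iter_Ly_monomial i p j :
  iter i Ly (p *: 'X^j) =
  \sum_(k < i.+1) (('C(i, k))%:R * iter k (Adelta h) p) *: 'X^(i + j - k).
Proof.
have bump0 k : bump 0 k = k.+1 by [].
elim: i => [|i IHi]; first by rewrite big_ord1 /= bin0 mul1r subn0.
rewrite iterS IHi raddf_sum /=.
under eq_bigr => k _ do rewrite LyZ Ly_Xn AdeltaZn.
(* The first sum gives up its term [k = 0] and the second its last term; the others pair up, [k + 1]
   with [k], under Pascal's rule. *)
rewrite big_split /= [X in X + _]big_ord_recl [X in _ + X]big_ord_recr /=.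
rewrite [RHS]big_ord_recl [X in _ = _ + X]big_ord_recr /=.
rewrite !bin0 !binn !subn0 addSn -!addrA; congr (_ + _); rewrite addrA.
congr (_ + _).
rewrite -big_split /=; apply: eq_bigr => k _.
rewrite bump0 binS natrD mulrDl scalerDl subSS; congr (_ *: 'X^ _ + _).
by rewrite -subSn //; apply: (leq_trans (ltn_ord k)); rewrite leq_addr.
Qed.

(** The working form of the product, linear over F[x] in the left factor; the ring axioms come from
    it rather than from the triple sum. *)
Lemma AmulE a b : Amul h a b = \sum_(i < size a) a`_i *: iter i Ly b.
Proof.
apply: eq_bigr => i _; rewrite -[in RHS](coefK b) poly_def raddf_sum /= scaler_sumr.
apply: eq_bigr => j _; rewrite iter_Ly_monomial scaler_sumr.
by apply: eq_bigr => k _; rewrite scalerA mulrCA mulrA.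
Qed.

Lemma AmulE_wide n a b : (size a <= n)%N ->
  Amul h a b = \sum_(i < n) a`_i *: iter i Ly b.
Proof.
move=> le_an; rewrite AmulE (big_ord_widen n (fun i => a`_i *: iter i Ly b)) //.
rewrite big_mkcond /=; apply: eq_bigr => i _.
by case: ltnP => // /(nth_default 0) ->; rewrite scale0r.
Qed.

Lemma AmulDl : left_distributive (Amul h) +%R.
Proof.
move=> a b c; have le_m := size_polyD a b.
rewrite (AmulE_wide _ le_m) (AmulE_wide c (leq_maxl (size a) (size b))).
rewrite (AmulE_wide c (leq_maxr (size a) (size b))) -big_split /=.
by apply: eq_bigr => i _; rewrite coefD scalerDl.
Qed.

Lemma AmulDr : right_distributive (Amul h) +%R.
Proof.
move=> a b c; rewrite !AmulE -big_split /=.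
by apply: eq_bigr => i _; rewrite raddfD scalerDr.
Qed.

Lemma AmulZl p a b : Amul h (p *: a) b = p *: Amul h a b.
Proof.
rewrite (AmulE_wide _ (size_scale_leq p a)) AmulE scaler_sumr.
by apply: eq_bigr => i _; rewrite coefZ scalerA.
Qed.

Lemma Amul1l : left_id 1 (Amul h).
Proof. by move=> a; rewrite AmulE size_poly1 big_ord1 coefC /= scale1r. Qed.

Lemma AmulCl p a : Amul h p%:P a = p *: a.
Proof. by rewrite -[p%:P]mulr1 mul_polyC AmulZl Amul1l. Qed.

Lemma iter_Ly1 i : iter i Ly 1 = 'X^i.
Proof. by elim: i => // i IHi; rewrite iterS IHi Ly_Xn. Qed.

Lemma Amul1r : right_id 1 (Amul h).
Proof.
move=> a; rewrite AmulE -[RHS]coefK poly_def.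
by apply: eq_bigr => i _; rewrite iter_Ly1.
Qed.

Lemma Amul0l a : Amul h 0 a = 0.
Proof. by rewrite AmulE size_poly0 big_ord0. Qed.

Lemma Amul_suml (I : Type) (r : seq I) (G : I -> {poly {poly F}}) b :
  Amul h (\sum_(i <- r) G i) b = \sum_(i <- r) Amul h (G i) b.
Proof.
by elim/big_rec2: _ => [|i y1 y2 _ <-]; rewrite ?Amul0l ?AmulDl.
Qed.

Lemma Amul_Xn n a : Amul h 'X^n a = iter n Ly a.
Proof.
rewrite AmulE size_polyXn big_ord_recr /= coefXn eqxx scale1r big1 ?add0r //.
by move=> i _; rewrite coefXn ltn_eqF ?scale0r ?ltn_ord.
Qed.

(** Associativity for the left factor yhat, checked on the monomials of [a]. Left linearity and
    induction on the power of yhat then give [AmulA]. *)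
Lemma Amul_Ly a b : Amul h (Ly a) b = Ly (Amul h a b).
Proof.
rewrite -[a]coefK poly_def raddf_sum !Amul_suml raddf_sum /=.
apply: eq_bigr => i _; rewrite LyZ AmulDl !AmulZl LyZ Ly_Xn.
by rewrite !Amul_Xn iterS.
Qed.

Lemma AmulA : associative (Amul h).
Proof.
move=> a b c; rewrite [in RHS](AmulE a b) Amul_suml AmulE.
apply: eq_bigr => i _; rewrite AmulZl; congr (_ *: _).
by elim: (i : nat) => //= j IHj; rewrite Amul_Ly IHj.
Qed.

(** Constants move across the left factor because [delta] kills them, so that [Ly] commutes with
    scaling by them. *)
Lemma AmulZpr (c : F) a b : Amul h a (c%:P *: b) = c%:P *: Amul h a b.
Proof.
rewrite !AmulE scaler_sumr; apply: eq_bigr => i _.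
rewrite scalerA mulrC -scalerA; congr (_ *: _).
by elim: (i : nat) => //= j ->; rewrite LyZ AdeltaC scale0r addr0.
Qed.

End Ore.

(* [Aalg h] carries the product [Amul h] and the scalars [F]; on the underlying
   [{poly {poly F}}], [*%R] is the commutative product, scaled by [{poly F}]. *)
Definition Aalg (F : fieldType) (h : {poly F}) : Type := {poly {poly F}}.

Section AalgStructure.
Variables (F : fieldType) (h : {poly F}).

HB.instance Definition _ := GRing.Zmodule.copy (Aalg h) {poly {poly F}}.

Fact Aone_neq0 : (1 : {poly {poly F}}) != 0.
Proof. exact: oner_neq0. Qed.

HB.instance Definition _ := GRing.Zmodule_isNzRing.Build (Aalg h)
  (@AmulA F h) (@Amul1l F h) (@Amul1r F h) (@AmulDl F h) (@AmulDr F h) Aone_neq0.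

Definition Ascale (c : F) (a : Aalg h) : Aalg h := c%:P *: (a : {poly {poly F}}).

Fact AscaleA c d a : Ascale c (Ascale d a) = Ascale (c * d) a.
Proof. by rewrite /Ascale scalerA polyCM. Qed.
Fact Ascale1 : left_id 1 Ascale.
Proof. by move=> a; rewrite /Ascale scale1r. Qed.
Fact AscaleDr : right_distributive Ascale +%R.
Proof. by move=> c a b; rewrite /Ascale scalerDr. Qed.
Fact AscaleDl a : {morph Ascale^~ a : c d / c + d}.
Proof. by move=> c d; rewrite /Ascale polyCD scalerDl. Qed.

HB.instance Definition _ := GRing.Zmodule_isLmodule.Build F (Aalg h)
  AscaleA Ascale1 AscaleDr AscaleDl.

Fact AscaleAl (c : F) (a b : Aalg h) : c *: (a * b) = (c *: a) * b.
Proof. by rewrite -[RHS]/(Amul h (c%:P *: (a : {poly {poly F}})) b) AmulZl. Qed.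
HB.instance Definition _ := GRing.Lmodule_isLalgebra.Build F (Aalg h) AscaleAl.

Fact AscaleAr (c : F) (a b : Aalg h) : c *: (a * b) = a * (c *: b).
Proof. by rewrite -[RHS]/(Amul h a (c%:P *: (b : {poly {poly F}}))) AmulZpr. Qed.
HB.instance Definition _ := GRing.Lalgebra_isAlgebra.Build F (Aalg h) AscaleAr.

End AalgStructure.

(** * Degree in yhat, and commutators modulo h *)

Section Degree.
Variables (F : fieldType) (h : {poly F}).
Implicit Types (p q : {poly F}) (a b : {poly {poly F}}).

Lemma Ly_lead a : a != 0 ->
  size (Ly h a) = (size a).+1 /\ lead_coef (Ly h a) = lead_coef a.
Proof.
move=> a0; have sXa : size ('X * a) = (size a).+1 by rewrite mulrC size_mulX.
have lt_a : (size (map_poly (Adelta h) a) < size ('X * a)%R)%N.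
  by rewrite sXa ltnS size_poly.
by rewrite size_polyDl // lead_coefDl // lead_coefM lead_coefX mul1r.
Qed.

Lemma iter_Ly_lead i a : a != 0 ->
  size (iter i (Ly h) a) = (i + size a)%N
  /\ lead_coef (iter i (Ly h) a) = lead_coef a.
Proof.
move=> a0; elim: i => //= i [sI lI].
have I0 : iter i (Ly h) a != 0.
  by rewrite -size_poly_gt0 sI addn_gt0 size_poly_gt0 a0 orbT.
by have [-> ->] := Ly_lead I0; rewrite sI lI.
Qed.

(** Only the leading term of [a] reaches the top degree in yhat: [iter i (Ly h) b] has degree
    [i + deg b], and F[x] is a domain. *)
Lemma Amul_lead a b : a != 0 -> b != 0 ->
  size (Amul h a b) = (size a + size b).-1
  /\ lead_coef (Amul h a b) = lead_coef a * lead_coef b.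
Proof.
move=> a0 b0; rewrite AmulE.
have la0 : lead_coef a != 0 by rewrite lead_coef_eq0.
case Ea: (size a) => [|n]; first by move: a0; rewrite -size_poly_eq0 Ea.
have [sI lI] := iter_Ly_lead n b0.
rewrite big_ord_recr /= addrC -[a`_n]/(a`_n.+1.-1) -Ea -[a`_(_)]/(lead_coef a).
set r := \sum_(i < n) _.
have sT : size (lead_coef a *: iter n (Ly h) b) = (n + size b)%N.
  by rewrite size_scale.
have lt_r : (size r < size (lead_coef a *: iter n (Ly h) b)%R)%N.
  have sb : (0 < size b)%N by rewrite size_poly_gt0.
  rewrite sT; apply: (@leq_ltn_trans (n + size b).-1); last first.
    by rewrite prednK // addn_gt0 sb orbT.
  apply: (leq_trans (size_sum _ _ _)); apply/bigmax_leqP=> i _.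
  apply: (leq_trans (size_scale_leq _ _)); have [-> _] := iter_Ly_lead i b0.
  by rewrite -ltnS prednK ?addn_gt0 ?sb ?orbT // ltn_add2r.
by rewrite size_polyDl // sT lead_coefDl // lead_coefZ lI.
Qed.

Lemma size_Aexp a n : a != 0 -> size (Aexp h a n) = (n * (size a).-1).+1.
Proof.
move=> a0; elim: n => [|n IHn]; first by rewrite size_poly1.
have e0 : Aexp h a n != 0 by rewrite -size_poly_gt0 IHn.
rewrite /Aexp iterS -/(Aexp h a n); have [-> _] := Amul_lead a0 e0.
have sa : (0 < size a)%N by rewrite size_poly_gt0.
by rewrite IHn addnS /= -{1}(prednK sa) mulSn addSn.
Qed.

(** When [a] has positive degree in yhat, its powers have strictly increasing degrees, so the last
    term dominates. This controls the degrees of the images of x and yhat under an automorphism. *)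
Lemma size_sum_Aexp (c : nat -> {poly F}) n a : (1 < size a)%N -> c n != 0 ->
  size (\sum_(i < n.+1) c i *: Aexp h a i) = (n * (size a).-1).+1.
Proof.
move=> sa cn0; have a0 : a != 0 by rewrite -size_poly_gt0 ltnW.
rewrite big_ord_recr /= addrC size_polyDl size_scale ?size_Aexp //.
rewrite ltnS; apply: (leq_trans (size_sum _ _ _)); apply/bigmax_leqP=> i _.
apply: (leq_trans (size_scale_leq _ _)); rewrite size_Aexp // ltn_mul2r ltn_ord.
by rewrite -ltnS prednK ?sa // ltnW.
Qed.

(** Every value of [delta] is a multiple of [h], so modulo [h] yhat acts as the commutative
    multiplication by ['X]. *)
Lemma iter_Ly_modh i b : exists c, iter i (Ly h) b = 'X^i * b + h *: c.
Proof.
elim: i => [|i [c IHi]]; first by exists 0; rewrite scaler0 addr0 mul1r.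
(* Coefficientwise derivation is what [map_poly (Adelta h)] leaves after the factor [h] is taken
   out. *)
exists ('X * c + map_poly (fun p => p^`()) (iter i (Ly h) b)).
rewrite iterS /Ly {1}IHi mulrDr mulrA -exprS -addrA -scalerAr scalerDr.
congr (_ + (_ + _)); apply/polyP=> j.
by rewrite coefZ !coef_map_id0 // /Adelta ?deriv0 ?mulr0.
Qed.

Lemma Amul_modh a b : exists c, Amul h a b = a * b + h *: c.
Proof.
have -> : a * b = \sum_(i < size a) a`_i *: 'X^i * b.
  by rewrite -mulr_suml -poly_def coefK.
rewrite AmulE.
elim/big_rec2: _ => [|i y1 y2 _ [c ->]]; first by exists 0; rewrite scaler0 addr0.
have [d ->] := iter_Ly_modh i b; exists (a`_i *: d + c).
rewrite !scalerDr !scalerA [h * _]mulrC -scalerAl.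
by rewrite addrACA.
Qed.

Lemma commutator_modh a b : exists c, Amul h a b - Amul h b a = h *: c.
Proof.
have [[c ->] [d ->]] := (Amul_modh a b, Amul_modh b a).
by exists (c - d); rewrite [b * a]mulrC opprD addrACA subrr add0r scalerBr.
Qed.

End Degree.

(** * Endomorphisms *)

Section Endomorphisms.
Variables (F : fieldType) (h : {poly F}).
Implicit Types (p q : {poly F}) (X Y a b : Aalg h).

Lemma AexpE X n : Aexp h X n = X ^+ n.
Proof. by elim: n => //= n IHn; rewrite exprS -IHn. Qed.

Lemma ApevalE p X : Apeval h p X = horner_alg X p.
Proof.
rewrite /horner_alg /horner_morph /= horner_coef size_map_poly.
by apply: eq_bigr => i _; rewrite coef_map /= mulr_algl -AexpE.
Qed.

Lemma AevE X Y a :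
  Aev h X Y a = \sum_(j < size (a : {poly {poly F}}))
     horner_alg X (a : {poly {poly F}})`_j * Y ^+ j.
Proof. by apply: eq_bigr => j _; rewrite ApevalE AexpE. Qed.

Lemma AevE_wide n X Y a : (size (a : {poly {poly F}}) <= n)%N ->
  Aev h X Y a = \sum_(j < n) horner_alg X (a : {poly {poly F}})`_j * Y ^+ j.
Proof.
move=> le_an; rewrite AevE.
rewrite (big_ord_widen n (fun j => horner_alg X (a : {poly {poly F}})`_j * Y ^+ j)) //.
rewrite big_mkcond /=; apply: eq_bigr => i _.
by case: ltnP => // /(nth_default 0) ->; rewrite rmorph0 mul0r.
Qed.

Lemma AevC X Y p : Aev h X Y p%:P = horner_alg X p.
Proof. by rewrite (AevE_wide _ _ (size_polyC_leq1 p)) big_ord1 coefC mulr1. Qed.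

Lemma Aev_Ay X Y : Aev h X Y (Ay F) = Y.
Proof.
rewrite AevE size_polyX big_ord_recr big_ord1 /= !coefX /=.
by rewrite rmorph0 rmorph1 mul0r add0r mul1r.
Qed.

Lemma AevD X Y : {morph Aev h X Y : a b / a + b}.
Proof.
move=> a b; pose n := maxn (size (a : {poly {poly F}})) (size (b : {poly {poly F}})).
rewrite (AevE_wide _ _ (size_polyD a b)) (AevE_wide _ _ (leq_maxl _ _ : _ <= n)%N).
rewrite (AevE_wide _ _ (leq_maxr _ _ : _ <= n)%N) -big_split /=.
by apply: eq_bigr => i _; rewrite coefD rmorphD mulrDl.
Qed.

Lemma AevZ X Y p (a : {poly {poly F}}) :
  Aev h X Y (p *: a) = horner_alg X p * Aev h X Y a.
Proof.
rewrite (AevE_wide _ _ (size_scale_leq p a)) AevE mulr_sumr.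
by apply: eq_bigr => i _; rewrite coefZ rmorphM mulrA.
Qed.

Lemma Aev0 X Y : Aev h X Y 0 = 0.
Proof. by rewrite AevE size_poly0 big_ord0. Qed.

Lemma Aev_sum X Y (I : Type) (r : seq I) (G : I -> {poly {poly F}}) :
  Aev h X Y (\sum_(i <- r) G i) = \sum_(i <- r) (Aev h X Y (G i) : Aalg h).
Proof.
by elim/big_rec2: _ => [|i y1 y2 _ <-]; rewrite ?Aev0 ?AevD.
Qed.

Lemma Aev_Xn X Y n : Aev h X Y 'X^n = Y ^+ n.
Proof.
rewrite AevE size_polyXn big_ord_recr /= coefXn eqxx rmorph1 mul1r big1 ?add0r //.
by move=> i _; rewrite coefXn ltn_eqF ?ltn_ord // rmorph0 mul0r.
Qed.

(** * The universal property of the defining relation *)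

Section Universal.
Variables (X Y : Aalg h).
Hypothesis relXY : Y * X - X * Y = horner_alg X h.

(** The commutator with [Y] is a derivation, so its value [h(X)] at [X] forces the value
    [h(X) p'(X)] at [p(X)]. *)
Lemma horner_alg_Adelta p :
  Y * horner_alg X p = horner_alg X p * Y + horner_alg X (Adelta h p).
Proof.
elim/poly_ind: p => [|p c IHp].
  by rewrite /Adelta deriv0 mulr0 !rmorph0 mulr0 mul0r addr0.
have -> : Adelta h (p * 'X + c%:P) = Adelta h p * 'X + h * p.
  by rewrite /Adelta derivD derivM derivX derivC mulr1 addr0 mulrDr mulrA.
have YX : Y * X = X * Y + horner_alg X h by rewrite -relXY addrC subrK.
move: (Adelta h p) IHp => q IHp.
rewrite !(rmorphD, rmorphM) /= horner_algX horner_algC mulrDr mulrA IHp !mulrDl.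
rewrite -!mulrA YX mulrDr -!scalerAr -!scalerAl mulr1 mul1r.
rewrite -[horner_alg X p * horner_alg X h]rmorphM [p * h]mulrC rmorphM /=.
rewrite -!addrA; congr (_ + _); rewrite [RHS]addrC addrA.
by congr (_ + _); rewrite addrC.
Qed.

(** [AmulE] builds products from [Ly], so multiplicativity of [Aev] reduces to this one rule. *)
Lemma Aev_Ly a : Aev h X Y (Ly h a) = Y * Aev h X Y a.
Proof.
rewrite -[a]coefK poly_def raddf_sum !Aev_sum mulr_sumr /=.
apply: eq_bigr => i _; rewrite LyZ AevD !AevZ Ly_Xn !Aev_Xn.
by rewrite !mulrA horner_alg_Adelta mulrDl exprS mulrA.
Qed.

Lemma AevM a b : Aev h X Y (Amul h a b) = Amul h (Aev h X Y a) (Aev h X Y b).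
Proof.
rewrite AmulE Aev_sum -[RHS]/((Aev h X Y a : Aalg h) * Aev h X Y b).
rewrite (AevE X Y a) mulr_suml; apply: eq_bigr => i _.
rewrite AevZ -mulrA.
suff -> : Aev h X Y (iter i (Ly h) b) = Y ^+ i * (Aev h X Y b : Aalg h) by [].
elim: (i : nat) => [|j IHj]; first by rewrite mul1r.
by rewrite iterS Aev_Ly IHj exprS mulrA.
Qed.

End Universal.

(** [is_Aut] without bijectivity, so that maps can be composed, inverted and compared on
    generators. *)
Definition is_endo (s : {poly {poly F}} -> {poly {poly F}}) : Prop :=
  [/\ forall a b, s (a + b) = s a + s b,
      forall (c : F) (a : {poly {poly F}}), s (c%:P *: a) = c%:P *: s a,
      s 1 = 1 &
      forall a b, s (Amul h a b) = Amul h (s a) (s b)].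

Lemma is_AutP s : is_Aut h s <-> bijective s /\ is_endo s.
Proof.
split=> [[bs sD sZ s1 sM]|[bs [sD sZ s1 sM]]].
  by split=> //; split=> // c a; rewrite -!mul_polyC sZ.
by split=> // c a; rewrite !mul_polyC sZ.
Qed.

Lemma Aev_endo X Y : Y * X - X * Y = horner_alg X h -> is_endo (Aev h X Y).
Proof.
move=> relXY; split.
- exact: AevD.
- by move=> c a; rewrite AevZ horner_algC mulr_algl.
- by rewrite AevC rmorph1.
- exact: AevM.
Qed.

Lemma is_endo_comp s t : is_endo s -> is_endo t -> is_endo (s \o t).
Proof.
move=> [sD sZ s1 sM] [tD tZ t1 tM].
split=> /= [a b|c a||a b]; by rewrite ?tD ?sD ?tZ ?sZ ?t1 ?s1 ?tM ?sM.
Qed.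

Lemma is_endo_id : is_endo id.
Proof. by []. Qed.

Lemma is_endo_ext s t : s =1 t -> is_endo t -> is_endo s.
Proof.
by move=> st [tD tZ t1 tM]; split=> [a b|c a||a b]; rewrite !st ?tD ?tZ ?t1 ?tM.
Qed.

Lemma is_endo_inv s t : cancel s t -> cancel t s -> is_endo s -> is_endo t.
Proof.
move=> st ts [sD sZ s1 sM]; split=> [a b|c a||a b]; apply: (can_inj st).
- by rewrite sD !ts.
- by rewrite sZ !ts.
- by rewrite ts s1.
- by rewrite sM !ts.
Qed.

Lemma is_endo0 s : is_endo s -> s 0 = 0.
Proof. by case=> sD _ _ _; apply: (addrI (s 0)); rewrite -sD !addr0. Qed.

Lemma is_endoN s : is_endo s -> {morph s : a / - a}.
Proof.
move=> es a; apply: (addrI (s a)); have [sD _ _ _] := es.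
by rewrite -sD !subrr is_endo0.
Qed.

Lemma is_endo_sum s (I : Type) (r : seq I) (G : I -> {poly {poly F}}) :
  is_endo s -> s (\sum_(i <- r) G i) = \sum_(i <- r) s (G i).
Proof.
move=> es; have [sD _ _ _] := es.
by elim/big_rec2: _ => [|i y1 y2 _ <-]; rewrite ?is_endo0 ?sD.
Qed.

Lemma is_endoX s a n : is_endo s -> s (Aexp h a n) = Aexp h (s a) n.
Proof. by case=> _ _ s1 sM; elim: n => //= n IHn; rewrite sM IHn. Qed.

Lemma Aalg_mulCl p a : (p%:P : Aalg h) * a = p *: (a : {poly {poly F}}).
Proof. exact: AmulCl. Qed.

Lemma Aalg_scalar (c : F) : c%:A = c%:P%:P :> Aalg h.
Proof. by rewrite -[LHS]/(c%:P *: (1 : {poly {poly F}})) alg_polyC. Qed.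

Lemma Ax_horner p : horner_alg (Ax F : Aalg h) p = p%:P.
Proof.
elim/poly_ind: p => [|p c IHp]; first by rewrite rmorph0 polyC0.
rewrite rmorphD rmorphM /= horner_algX horner_algC IHp.
by rewrite Aalg_mulCl Aalg_scalar polyCD polyCM mul_polyC.
Qed.

Lemma Amul_Ay (a : {poly {poly F}}) : Amul h (Ay F) a = Ly h a.
Proof. by rewrite (_ : Ay F = 'X^1) // Amul_Xn. Qed.

Lemma Aexp_Ay n : Aexp h (Ay F) n = 'X^n.
Proof. by elim: n => // n IHn; rewrite -(Ly_Xn h) -IHn -Amul_Ay. Qed.

Lemma Aev_id : Aev h (Ax F) (Ay F) =1 id.
Proof.
move=> a; rewrite AevE -[RHS]coefK poly_def; apply: eq_bigr => i _.
by rewrite Ax_horner -AexpE Aalg_mulCl Aexp_Ay.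
Qed.

Lemma is_endo_C s p : is_endo s -> s p%:P = Apeval h p (s (Ax F)).
Proof.
move=> es; rewrite -Ax_horner -ApevalE is_endo_sum //.
by have [_ sZ _ _] := es; apply: eq_bigr => i _; rewrite sZ is_endoX.
Qed.

(** Normal forms are built from x and yhat, whose images therefore determine [s]. Through
    [endo_ext], identities between compositions of [phi] and [tau] reduce to two checks. *)
Lemma is_endo_Aev s : is_endo s -> s =1 Aev h (s (Ax F)) (s (Ay F)).
Proof.
move=> es a; rewrite -{1}[a]Aev_id is_endo_sum //.
have [_ sZ _ sM] := es; apply: eq_bigr => i _.
by rewrite sM is_endoX // ApevalE Ax_horner is_endo_C.
Qed.

Lemma endo_ext s t : is_endo s -> is_endo t ->
  s (Ax F) = t (Ax F) -> s (Ay F) = t (Ay F) -> s =1 t.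
Proof. by move=> es et eX eY a; rewrite (is_endo_Aev es) (is_endo_Aev et) eX eY. Qed.

Lemma horner_algC_comp p q : horner_alg (q%:P : Aalg h) p = (p \Po q)%:P.
Proof.
elim/poly_ind: p => [|p c IHp]; first by rewrite rmorph0 comp_poly0 polyC0.
rewrite rmorphD rmorphM /= horner_algX horner_algC IHp comp_poly_MXaddC.
by rewrite Aalg_mulCl Aalg_scalar polyCD polyCM mul_polyC.
Qed.

End Endomorphisms.

(** * The automorphisms tau and phi *)

Local Notation aff al be := (al%:P * 'X + be%:P).

Section Affine.
Variable R : idomainType.
Implicit Types (al be : R).

Lemma aff_inj al be al' be' :
  aff al be = aff al' be' -> al = al' /\ be = be'.
Proof.
move=> E; split.
  by have := congr1 (coefp 1) E; rewrite /= !coefD !coefCM !coefX !coefC !mulr1 !addr0.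
by have := congr1 (coefp 0) E; rewrite /= !coefD !coefCM !coefX !coefC !mulr0 !add0r.
Qed.

Lemma aff_comp al be al' be' :
  aff al' be' \Po aff al be = aff (al * al') (al' * be + be').
Proof.
rewrite comp_polyD comp_polyM !comp_polyC comp_polyX polyCD !polyCM mulrDr addrA.
by rewrite mulrA [al'%:P * al%:P]mulrC.
Qed.

Lemma size_aff al be : al != 0 -> size (aff al be) = 2%N.
Proof.
move=> al0; have sX : size (al%:P * 'X) = 2%N by rewrite mul_polyC size_scale ?size_polyX.
by rewrite size_polyDl sX // ltnS size_polyC_leq1.
Qed.

Lemma lead_coef_aff al be : al != 0 -> lead_coef (aff al be) = al.
Proof.
by move=> al0; rewrite lead_coefE size_aff // coefD coefCM coefX coefC mulr1 addr0.
Qed.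

Lemma size2_aff (p : {poly R}) :
  size p = 2%N -> p = aff p`_1 p`_0 /\ p`_1 != 0.
Proof.
move=> sp; split.
  rewrite -{1}[p]coefK sp poly_def big_ord_recr big_ord1 /= expr1.
  by rewrite alg_polyC addrC mul_polyC.
by rewrite -[p`_1]/(p`_(2.-1)) -sp -lead_coefE lead_coef_eq0 -size_poly_gt0 sp.
Qed.

Lemma polyZI (p : R) : p != 0 -> injective (fun a : {poly R} => p *: a).
Proof.
move=> p0 a b /=; rewrite -!mul_polyC => /mulfI -> //.
by rewrite polyC_eq0.
Qed.

End Affine.

Section TauPhi.
Variables (F : fieldType) (h : {poly F}).
Hypothesis sh : (1 < size h)%N.
Implicit Types (f g p q r : {poly F}) (al be : F).

Lemma Ly_C p : Ly h p%:P = p *: 'X + (Adelta h p)%:P.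
Proof. by rewrite /Ly map_polyC /= mulrC mul_polyC. Qed.

(** [r] commutes with [p] and drops out. The rule verifies the relation for [tau] and [phi], and
    later yields the leading coefficient of [s yhat]. *)
Lemma commutator_linear p q r :
  Amul h (q *: 'X + r%:P) p%:P - Amul h p%:P (q *: 'X + r%:P) = (q * Adelta h p)%:P.
Proof.
rewrite AmulDl AmulZl (Amul_Ay h) !AmulCl Ly_C !scalerDr !scalerA.
rewrite -!mul_polyC -!polyCM [p * q]mulrC [p * r]mulrC.
by rewrite opprD addrACA subrr addr0 addrAC subrr add0r.
Qed.

Lemma degh_gt0 : (0 < degh h)%N.
Proof. by rewrite /degh -ltnS prednK // ltnW. Qed.

Lemma inP_tau_rel al be : inP h al be ->
  [/\ al != 0, h \Po aff al be = al ^+ degh h *: h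
    & al ^+ (degh h).-1 * al = al ^+ degh h].
Proof.
by case/andP=> al0 /eqP E; split=> //; rewrite -exprSr prednK // degh_gt0.
Qed.

Lemma tau_endo al be : inP h al be -> is_endo h (tau h al be).
Proof.
case/inP_tau_rel=> al0 hE alE; apply: Aev_endo.
(* The commutator of the two images is [al ^ (deg h - 1) * al * h]; membership in P equates it with
   [h (al x + be)]. *)
rewrite horner_algC_comp hE.
have := commutator_linear (aff al be) (al ^+ (degh h).-1)%:P 0.
rewrite polyC0 addr0 => ->; congr (_%:P).
rewrite /Adelta derivD derivM !derivC derivX mul0r add0r mulr1 addr0.
by rewrite mulrCA -polyCM alE mulrC mul_polyC.
Qed.

Lemma phi_endo f : is_endo h (phi h f).
Proof.
apply: Aev_endo; rewrite Ax_horner.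
have := commutator_linear 'X 1 f; rewrite scale1r /Ax /Ay => ->.
by rewrite /Adelta derivX mulr1 mul1r.
Qed.

Lemma tau_C al be p : tau h al be p%:P = (p \Po aff al be)%:P.
Proof. by rewrite /tau AevC horner_algC_comp. Qed.

Lemma tau_Ax al be : tau h al be (Ax F) = (aff al be)%:P.
Proof. by rewrite /Ax tau_C comp_polyX. Qed.

Lemma tau_Ay al be : tau h al be (Ay F) = (al ^+ (degh h).-1)%:P *: Ay F.
Proof. exact: Aev_Ay. Qed.

Lemma phi_C f p : phi h f p%:P = p%:P.
Proof. by rewrite /phi AevC Ax_horner. Qed.

Lemma phi_Ay f : phi h f (Ay F) = Ay F + f%:P.
Proof. exact: Aev_Ay. Qed.

Lemma inP_comp al be al' be' : inP h al be -> inP h al' be' ->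
  inP h (al * al') (al' * be + be').
Proof.
case/andP=> al0 /eqP E /andP[al'0 /eqP E']; rewrite /inP mulf_neq0 //=.
by rewrite -aff_comp comp_polyA E' comp_polyZ E scalerA exprMn mulrC.
Qed.

Lemma inP10 : inP h 1 0.
Proof. by rewrite /inP oner_neq0 polyC0 addr0 mul1r comp_polyXr expr1n scale1r eqxx. Qed.

Lemma inPV al be : inP h al be -> inP h al^-1 (- (al^-1 * be)).
Proof.
case/andP=> al0 /eqP E; rewrite /inP invr_neq0 //=.
apply/eqP; apply: (scalerI (expf_neq0 (degh h) al0)).
rewrite -comp_polyZ -E -comp_polyA aff_comp mulVf // mulrN mulrA mulfV //.
rewrite !mul1r addNr polyC0 addr0 comp_polyXr scalerA -exprMn mulfV //.
by rewrite expr1n scale1r.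
Qed.

Lemma tau_comp al be al' be' : inP h al be -> inP h al' be' ->
  tau h al be \o tau h al' be' =1 tau h (al * al') (al' * be + be').
Proof.
move=> P P'; have e := tau_endo P; have e' := tau_endo P'.
apply: (endo_ext (is_endo_comp e e') (tau_endo (inP_comp P P'))) => /=.
  by rewrite !tau_Ax tau_C aff_comp.
by rewrite !tau_Ay; case: e => _ eZ _ _; rewrite eZ tau_Ay scalerA -polyCM exprMn mulrC.
Qed.

Lemma tau10 : tau h 1 0 =1 id.
Proof.
apply: (endo_ext (tau_endo inP10) (is_endo_id h)).
  by rewrite tau_Ax polyC0 mul1r addr0.
by rewrite tau_Ay expr1n scale1r.
Qed.

Lemma tau_inj al be al' be' :
  tau h al be =1 tau h al' be' -> al = al' /\ be = be'.
Proof. by move/(_ (Ax F)); rewrite !tau_Ax => /polyC_inj/aff_inj. Qed.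

Lemma tau_invl al be : inP h al be ->
  cancel (tau h al be) (tau h al^-1 (- (al^-1 * be))).
Proof.
move=> P a; rewrite -[LHS]/((_ \o _) a) (tau_comp (inPV P) P).
have [al0 _] := andP P.
by rewrite mulVf // mulrN mulrA mulfV // mul1r addNr tau10.
Qed.

Lemma tau_invr al be : inP h al be ->
  cancel (tau h al^-1 (- (al^-1 * be))) (tau h al be).
Proof.
move=> P a; rewrite -[LHS]/((_ \o _) a) (tau_comp P (inPV P)).
have [al0 _] := andP P.
by rewrite mulfV // subrr tau10.
Qed.

Lemma tau_Aut al be : inP h al be -> is_Aut h (tau h al be).
Proof.
move=> P; apply/is_AutP; split; last exact: tau_endo.
by exists (tau h al^-1 (- (al^-1 * be))); [exact: tau_invl | exact: tau_invr].
Qed.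

Lemma phi_comp f g : phi h f \o phi h g =1 phi h (f + g).
Proof.
apply: (endo_ext (is_endo_comp (phi_endo f) (phi_endo g)) (phi_endo _)) => /=.
  by rewrite !phi_C.
have [eD _ _ _] := phi_endo f.
by rewrite !phi_Ay eD phi_Ay phi_C polyCD addrA.
Qed.

Lemma phi0 : phi h 0 =1 id.
Proof.
by apply: (endo_ext (phi_endo 0) (is_endo_id h)); rewrite ?phi_C // phi_Ay polyC0 addr0.
Qed.

Lemma phi_Aut f : is_Aut h (phi h f).
Proof.
apply/is_AutP; split; last exact: phi_endo.
by exists (phi h (- f)) => a; rewrite -[LHS]/((_ \o _) a) phi_comp ?addNr ?addrN phi0.
Qed.

Lemma is_Aut_comp s t : is_Aut h s -> is_Aut h t -> is_Aut h (s \o t).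
Proof.
move=> /is_AutP[bs es] /is_AutP[bt et]; apply/is_AutP.
by split; [exact: bij_comp | exact: is_endo_comp].
Qed.

Lemma is_Aut_ext s t : s =1 t -> is_Aut h t -> is_Aut h s.
Proof.
move=> st /is_AutP[bt et]; apply/is_AutP; split; last exact: is_endo_ext st et.
exact: (eq_bij bt (fsym st)).
Qed.

(** At yhat the right side adds [g (al x + be)] where the left adds [al ^ (deg h - 1) f]; hence [g]
    involves the inverse substitution. *)
Lemma phi_tau f al be : inP h al be ->
  phi h f \o tau h al be =1
  tau h al be \o
    phi h (al ^+ (degh h).-1 *: (f \Po (al^-1%:P * 'X - (al^-1 * be)%:P))).
Proof.
move=> P; have [al0 _] := andP P.
have eT := tau_endo P; have [TD _ _ _] := eT.
have [_ fZ _ _] := phi_endo f.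
apply: (endo_ext (is_endo_comp (phi_endo f) eT) (is_endo_comp eT (phi_endo _))) => /=.
  by rewrite phi_C tau_Ax phi_C.
rewrite tau_Ay fZ !phi_Ay TD tau_Ay tau_C comp_polyZ -comp_polyA.
rewrite -[- (_ * _)%:P]polyCN aff_comp mulfV // addrN polyC0 addr0 mul1r.
by rewrite comp_polyXr scalerDr -[_ *: f%:P]mul_polyC -polyCM mul_polyC.
Qed.

Lemma phi_tau_inj f f' al be al' be' : al != 0 ->
  phi h f \o tau h al be =1 phi h f' \o tau h al' be' ->
  [/\ f = f', al = al' & be = be'].
Proof.
move=> al0 E; have := E (Ax F); rewrite /= !tau_Ax !phi_C.
case/polyC_inj/aff_inj=> eal ebe; subst al' be'; split=> //.
have [[_ fZ _ _] [_ fZ' _ _]] := (phi_endo f, phi_endo f').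
have := E (Ay F); rewrite /= !tau_Ay fZ fZ' !phi_Ay.
have c0 : (al ^+ (degh h).-1)%:P != 0 by rewrite polyC_eq0 expf_neq0.
by move/(polyZI c0)/addrI/polyC_inj.
Qed.

Lemma phi_inj f f' : phi h f =1 phi h f' -> f = f'.
Proof. by move/(_ (Ay F)); rewrite !phi_Ay => /addrI/polyC_inj. Qed.

End TauPhi.

(** * Every automorphism is some phi_f composed with some tau *)

Section Classification.
Variables (F : fieldType) (h : {poly F}).
Hypothesis sh : (1 < size h)%N.

Let h0 : h != 0.
Proof. by rewrite -size_poly_gt0 ltnW. Qed.

Lemma commutator_Ay_Ax :
  Amul h (Ay F) (Ax F) - Amul h (Ax F) (Ay F) = h%:P.
Proof.
have := commutator_linear h 'X 1 0; rewrite scale1r polyC0 addr0 => ->.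
by rewrite /Adelta derivX mulr1 mul1r.
Qed.

Lemma is_endo_commutator s : is_endo h s ->
  Amul h (s (Ay F)) (s (Ax F)) - Amul h (s (Ax F)) (s (Ay F)) = s h%:P.
Proof.
move=> es; rewrite -commutator_Ay_Ax; have [sD _ _ sM] := es.
by rewrite sD (is_endoN es) !sM.
Qed.

Lemma polyC_of_size1 (a : {poly {poly F}}) : (size a <= 1)%N -> exists p, a = p%:P.
Proof. by move/size1_polyC=> ->; exists a`_0. Qed.

(** Both [s h = h u] and [t h = h v] are commutators. Applying [t] to the first gives
    [h = h v t(u)], so [t u] is a unit, hence a scalar, and so is [u]. *)
Lemma Aut_h s t : cancel s t -> cancel t s -> is_endo h s ->
  exists c : F, s h%:P = (c *: h)%:P.
Proof.
move=> st ts es; have et := is_endo_inv st ts es.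
have [u su] := commutator_modh h (s (Ay F)) (s (Ax F)).
have [v tv] := commutator_modh h (t (Ay F)) (t (Ax F)).
rewrite is_endo_commutator // in su; rewrite is_endo_commutator // in tv.
have E1 : Amul h v (t u) = 1.
  apply: (polyZI h0); rewrite -AmulZl -tv; have [_ _ _ tM] := et.
  by rewrite -tM AmulCl -su st -mul_polyC mulr1.
have v0 : v != 0.
  by apply/eqP=> v0; move/eqP: E1; rewrite v0 Amul0l eq_sym oner_eq0.
have tu0 : t u != 0.
  apply/eqP=> tu0; move/eqP: E1; rewrite tu0.
  by rewrite -[Amul _ _ _]/((v : Aalg h) * 0) mulr0 eq_sym oner_eq0.
have [sE lE] := Amul_lead h v0 tu0.
rewrite E1 size_poly1 in sE.
(* The sizes are positive and add up to 2, so both factors lie in F[x]. *)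
have [v1 tu1] : (size v <= 1)%N /\ (size (t u) <= 1)%N.
  move: v0 tu0 sE; rewrite -!size_poly_gt0.
  case: (size v) => // -[|n]; case: (size (t u)) => // -[|m] //;
  by rewrite addnS /= ?addSn.
have [q tuq] := polyC_of_size1 tu1; have [p vp] := polyC_of_size1 v1.
move: E1; rewrite tuq vp AmulCl -mul_polyC -polyCM => /polyC_inj pq1.
have /size_poly1P[c c0 qc] : size q == 1%N.
  move: (congr1 (fun p => size (polyseq p)) pq1); rewrite size_poly1.
  have [->|p0] := eqVneq p 0; first by rewrite mul0r size_poly0.
  have [->|q0] := eqVneq q 0; first by rewrite mulr0 size_poly0.
  rewrite size_mul //; move: p0 q0; rewrite -!size_poly_gt0.
  by case: (size p) => // -[|n]; case: (size q) => // -[|m] //; rewrite addnS /= ?addSn.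
exists c; rewrite su; have [_ sZ s1 _] := es.
have -> : u = c%:P%:P.
  by rewrite -[u]ts tuq qc -[c%:P%:P]mulr1 mul_polyC sZ s1.
by rewrite -mul_polyC -polyCM mulrC mul_polyC.
Qed.

(** Otherwise [h (s x)] would have positive degree in yhat, whereas it equals [s h = c h]. *)
Lemma Aut_Ax_size s t : cancel s t -> cancel t s -> is_endo h s ->
  (size (s (Ax F)) <= 1)%N.
Proof.
move=> st ts es; have [c sc] := Aut_h st ts es.
rewrite leqNgt; apply/negP=> lt1.
have := congr1 (fun p => size (polyseq p)) sc; rewrite (is_endo_C h es) /Apeval.
rewrite -(prednK (ltnW sh)) (@size_sum_Aexp _ _ (fun i => (h`_i)%:P)) //; last first.
  by rewrite polyC_eq0 -lead_coefE lead_coef_eq0.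
move=> E; have := size_polyC_leq1 (c *: h); rewrite -E leqNgt => /negP; apply.
by rewrite ltnS muln_gt0 -!subn1 !subn_gt0 sh.
Qed.

Lemma Aut_factor s : is_Aut h s ->
  exists f al be, inP h al be /\ s =1 phi h f \o tau h al be.
Proof.
case/is_AutP=> [[t st ts] es]; have et := is_endo_inv st ts es.
have [p sp] := polyC_of_size1 (Aut_Ax_size st ts es).
have [q tq] := polyC_of_size1 (Aut_Ax_size ts st et).
(* Apply [t] to [s x = p(x)]; the degrees of [p] and [q] then multiply to 1. *)
have pq : p \Po q = 'X.
  apply: polyC_inj; rewrite -(horner_algC_comp h) -ApevalE -tq.
  by rewrite -(is_endo_C p et) -sp st.
have sp2 : size p = 2%N.
  have := size_comp_poly p q; rewrite pq size_polyX => /esym/eqP.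
  rewrite muln_eq1 => /andP[/eqP E _].
  by case: (size p) E => // n /= ->.
have [pE al0] := size2_aff sp2.
move: {pE}(p`_1) (p`_0) al0 pE => al be al0 pE; subst p.
have [c sc] := Aut_h st ts es.
have hc : h \Po aff al be = c *: h.
  apply: polyC_inj; rewrite -sc -(horner_algC_comp h) -ApevalE -sp.
  by rewrite -(is_endo_C h es).
have cE : c = al ^+ degh h.
  have := congr1 lead_coef hc; rewrite lead_coef_comp ?size_aff //.
  rewrite lead_coef_aff // lead_coefZ mulrC => /mulIf -> //.
  by rewrite lead_coef_eq0.
have P : inP h al be by rewrite /inP al0 hc cE eqxx.
have [_ _ alE] := inP_tau_rel sh P.
(* In degree 0, [s yhat] would commute with [s x], forcing [s h = 0]. *)
have sY1 : (1 < size (s (Ay F)))%N.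
  rewrite ltnNge; apply/negP=> /polyC_of_size1[r sr].
  have := is_endo_commutator es; rewrite sp sr !AmulCl -!mul_polyC -!polyCM.
  rewrite mulrC subrr -{1}(is_endo0 es) => /(can_inj st)/esym/eqP.
  by rewrite polyC_eq0 (negPf h0).
(* Since [yhat = s b], the product of the degrees of [b] and [s yhat] is 1. *)
have sY2 : size (s (Ay F)) = 2%N.
  set b := t (Ay F).
  have b0 : b != 0.
    apply/eqP=> b0; have := ts (Ay F); rewrite -/b b0 (is_endo0 es).
    by move/eqP; rewrite eq_sym polyX_eq0.
  have sb : (0 < size b)%N by rewrite size_poly_gt0.
  have := congr1 (fun p => size (polyseq p)) (ts (Ay F)).
  rewrite -/b (is_endo_Aev es) /Aev.
  under eq_bigr => j _ do rewrite ApevalE sp horner_algC_comp AmulCl.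
  rewrite -(prednK sb) (@size_sum_Aexp _ _ (fun j => b`_j \Po aff al be)) //.
    rewrite size_polyX => -[] /eqP; rewrite muln_eq1 => /andP[_ /eqP E].
    by case: (size (s (Ay F))) E => // n /= ->.
  by rewrite comp_poly2_eq0 ?size_aff // -lead_coefE lead_coef_eq0.
have [sYE q0] := size2_aff sY2.
move: sYE; move: (s (Ay F))`_1 (s (Ay F))`_0 => q' r sYE.
have q'E : q' = (al ^+ (degh h).-1)%:P.
  have := is_endo_commutator es; rewrite sp sYE mul_polyC commutator_linear sc cE.
  move/polyC_inj; rewrite /Adelta derivD derivM !derivC derivX mul0r add0r mulr1 addr0.
  rewrite -alE mulrCA mulrC -mul_polyC => /mulIf; move/(_ h0).
  rewrite polyCM => /mulIf; apply.
  by rewrite polyC_eq0.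
(* [phi_f] acts after yhat has been scaled by [al ^ (deg h - 1)], which also multiplies [f]; the
   inverse factor compensates. *)
exists ((al ^+ (degh h).-1)^-1 *: r), al, be; split=> //.
have [_ fZ _ _] := phi_endo h ((al ^+ (degh h).-1)^-1 *: r).
apply: (endo_ext es (is_endo_comp (phi_endo h _) (tau_endo sh P))) => /=.
  by rewrite tau_Ax phi_C sp.
rewrite tau_Ay fZ phi_Ay scalerDr sYE q'E -!mul_polyC -polyCM; congr (_ + _%:P).
by rewrite mulrA -polyCM mulfV ?expf_neq0 // mul1r.
Qed.

End Classification.

(** * Roots of h and the group P *)

(* Multiplication by [a] permutes [rs], so it preserves the product of [rs]. *)
Lemma stable_seq_exp1 (K : fieldType) (rs : seq K) (a : K) :
  uniq rs -> 0 \notin rs -> a != 0 -> {in rs, forall z, a * z \in rs} ->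
  a ^+ size rs = 1.
Proof.
move=> Urs rs0 a0 ars.
have Ua : uniq (map ( *%R a) rs) by rewrite map_inj_uniq //; apply: mulfI.
have sub : {subset map ( *%R a) rs <= rs} by move=> _ /mapP[z /ars ? ->].
have [_ eqi] := uniq_min_size Ua sub (eq_leq (esym (size_map _ _))).
have : \prod_(z <- map ( *%R a) rs) z = \prod_(z <- rs) z.
  by apply: perm_big; apply: uniq_perm.
rewrite big_map big_split /= big_const_seq count_predT iter_mulr_1.
rewrite -[RHS]mul1r => /mulIf; apply.
rewrite prodf_seq_neq0; apply/allP=> z zrs /=.
by apply: contraNneq rs0 => <-.
Qed.

(* Classical: being in the image of [u] need not be decidable. *)
Lemma finite_preimage (A B : eqType) (u : A -> B) (Q : A -> Prop) (C : seq B) :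
  injective u -> (forall x, Q x -> u x \in C) ->
  exists2 rs, uniq rs & forall x, x \in rs <-> Q x.
Proof.
move=> u_inj; elim: C Q => [|c C IHC] Q QC.
  by exists [::] => // x; split=> // /QC.
have [[a [Qa uac]]|noQ] := classic (exists a, Q a /\ u a = c); last first.
  apply: IHC => x Qx; have := QC x Qx; rewrite inE => /orP[/eqP uxc|//].
  by case: noQ; exists x.
have [|rs Urs rsQ] := IHC (fun x => Q x /\ x != a).
  move=> x [Qx xa]; have := QC x Qx; rewrite inE -uac => /orP[/eqP/u_inj xa'|//].
  by rewrite xa' eqxx in xa.
exists (a :: rs); first by rewrite /= Urs andbT; apply/negP=> /rsQ[_]; rewrite eqxx.
move=> x; rewrite inE; split=> [/orP[/eqP->//|/rsQ[]//]|Qx].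
by have [//|xa] := eqVneq x a; apply/rsQ.
Qed.

Lemma comp_shift (T : Type) (p p' t t' u : T -> T) :
  t \o u =1 u \o t' -> p \o u =1 u \o p' -> p \o t \o u =1 u \o p' \o t'.
Proof. by move=> tu pu x; have /= -> := tu x; apply: pu. Qed.

(** * Powers, cosets and conjugates among the [tau] *)

Section TauGroup.
Variables (F : fieldType) (h : {poly F}).
Hypothesis sh : (1 < size h)%N.
Implicit Types (al be mu nu : F).

(** The last clause records that a fixed point [mu] of [al z + be] is fixed by all powers. *)
Lemma fpow_tau al be i : inP h al be ->
  exists b, [/\ inP h (al ^+ i) b, fpow (tau h al be) i =1 tau h (al ^+ i) b
    & forall mu, be = (1 - al) * mu -> b = (1 - al ^+ i) * mu].
Proof.
move=> P; elim: i => [|i [b [Pb Eb Mb]]].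
  exists 0; split=> [||mu _]; first exact: inP10.
    by move=> a; rewrite tau10.
  by rewrite subrr mul0r.
exists (al ^+ i * be + b); rewrite exprS; split; first exact: inP_comp.
  by move=> a; rewrite -(tau_comp sh P Pb) [RHS]/= -Eb.
move=> mu Emu; rewrite (Mb mu Emu) Emu mulrA -mulrDl mulrBr mulr1 addrC subrKA.
by rewrite [al ^+ i * al]mulrC.
Qed.

(** The whole cyclic group fixes [mu], so it contains no nontrivial translation; this makes it a
    complement. *)
Lemma in_cyc_tau al be mu c : inP h al be -> be = (1 - al) * mu ->
  in_cyc (tau h al be) c ->
  exists a b, [/\ inP h a b, c =1 tau h a b & b = (1 - a) * mu].
Proof.
move=> P Emu [i Hc]; have [b [Pb Eb /(_ mu Emu) Mb]] := fpow_tau i P.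
have [al0 _] := andP Pb.
case: Hc => Hc; first by exists (al ^+ i), b; split=> // x; rewrite Hc Eb.
exists (al ^+ i)^-1, (- ((al ^+ i)^-1 * b)); split; first exact: inPV.
  by move=> x; rewrite -{1}[x](tau_invr sh Pb) -Eb; apply: Hc.
by rewrite Mb mulrA mulrBr mulr1 mulVf // -mulNr opprB.
Qed.

Lemma tau_split al be b : inP h al be -> inP h al b ->
  exists2 nu, inG h nu & tau h al be =1 tau h 1 nu \o tau h al b.
Proof.
move=> P Pb; have [al0 _] := andP P.
have Pnu := inP_comp P (inPV Pb); rewrite mulfV // in Pnu.
exists (al^-1 * be + - (al^-1 * b)); first exact: Pnu.
have beE : al * (al^-1 * be + - (al^-1 * b)) + b = be.
  by rewrite mulrDr mulrN !mulrA !mulfV // !mul1r subrK.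
have := tau_comp sh Pnu Pb; rewrite mul1r beE; exact: fsym.
Qed.

Lemma tau_conj al be nu : inP h al be -> inG h nu ->
  inG h (al * nu) /\ tau h 1 nu \o tau h al be =1 tau h al be \o tau h 1 (al * nu).
Proof.
move=> P Pnu; have [al0 _] := andP P.
have Q : inP h 1 (al * nu).
  (* Conjugating the translation by [nu] inside P gives the translation by [al * nu]. *)
  have := inP_comp (inP_comp (inPV P) Pnu) P.
  rewrite mulr1 mulVf // mul1r mulrDr mulrN mulrA mulfV // mul1r.
  by rewrite addrAC addNr add0r.
split; first exact: Q.
have E := tau_comp sh Pnu P; have := tau_comp sh P Q.
rewrite mulr1 mul1r [be + _]addrC => E'; rewrite mul1r in E.
exact: ftrans E (fsym E').
Qed.

End TauGroup.

(** * The action of P on the roots of [h] *)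

Section Roots.
Variables (F : fieldType) (L : closedFieldType) (iota : {rmorphism F -> L}).
Variables (h : {poly F}) (s : seq L).
Hypotheses (sh : (1 < size h)%N) (Us : uniq s).
Hypothesis rs : forall z : L, root (map_poly iota h) z = (z \in s).
Implicit Types (al be nu : F).

Lemma inP_roots al be z : inP h al be ->
  (iota al * z + iota be \in s) = (z \in s).
Proof.
case/andP=> al0 /eqP E; rewrite -!rs /root.
have := congr1 (fun p => (map_poly iota p).[z]) E.
rewrite map_comp_poly horner_comp rmorphD rmorphM /= !map_polyC map_polyX /=.
rewrite !hornerE => ->; rewrite map_polyZ hornerZ mulf_eq0 fmorph_eq0.
by rewrite expf_eq0 (negPf al0) andbF.
Qed.

Lemma inP_single lam al be : s = [:: lam] -> inP h al be ->
  iota be = (1 - iota al) * lam.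
Proof.
move=> Es P; have := inP_roots lam P; rewrite Es !inE eqxx => /eqP E.
by rewrite mulrBl mul1r -[X in X - _]E addrAC subrr add0r.
Qed.

(** Over [L], [h] is [c (x - l)^d], and the substitution turns [x - l] into [al (x - l)]; the
    identity descends since [iota] is injective. *)
Lemma single_inP (l al : F) : s = [:: iota l] -> al != 0 ->
  inP h al ((1 - al) * l).
Proof.
move=> Es al0; rewrite /inP al0 /=; apply/eqP; apply: (map_poly_inj iota).
rewrite map_comp_poly map_polyZ rmorphD rmorphM /= !map_polyC map_polyX /=.
have [r hr] := closed_field_poly_normal (map_poly iota h).
have lc0 : lead_coef (map_poly iota h) != 0.
  by rewrite lead_coef_eq0 map_poly_eq0 -size_poly_gt0 ltnW.
have rl : all (pred1 (iota l)) r.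
  apply/allP=> z zr /=; have : z \in s; last by rewrite Es inE.
  by rewrite -rs hr rootZ // root_prod_XsubC.
move: (lead_coef _) lc0 hr => c c0 hr.
have {}hr : map_poly iota h = c *: ('X - (iota l)%:P) ^+ size r.
  by rewrite hr {1}(all_pred1P _ _ rl) big_nseq iter_mulr_1.
have -> : degh h = size r.
  by rewrite /degh -(size_map_poly iota) hr size_scale // size_exp_XsubC.
have expPo (p q : {poly L}) m : (p ^+ m) \Po q = (p \Po q) ^+ m by exact: rmorphXn.
rewrite hr comp_polyZ expPo comp_polyB comp_polyX comp_polyC.
rewrite !scalerA [_ * c]mulrC -scalerA rmorphXn -exprZn; congr (_ *: _ ^+ _).
rewrite rmorphM rmorphB rmorph1 mulrBl mul1r polyCB polyCM -mul_polyC mulrBr.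
by rewrite addrA addrAC addrK.
Qed.

Hypothesis s2 : (1 < size s)%N.

Lemma alphas_finite : exists2 als : seq F,
  uniq als & forall al, al \in als <-> exists be, inP h al be.
Proof.
case Es: s s2 Us => [|z0 [|z1 s']] // _ /= /andP[]; rewrite inE negb_or => /andP[z01 _] _.
(* Two distinct roots [z0], [z1] go to roots [w0], [w1], and [al] is the quotient of the
   differences. *)
apply: (@finite_preimage _ _ iota _ [seq (w1 - w0) / (z1 - z0) | w1 <- s, w0 <- s]).
  exact: fmorph_inj.
move=> al [be P]; apply/allpairsP.
exists (iota al * z1 + iota be, iota al * z0 + iota be).
rewrite /= !inP_roots // Es !inE !eqxx orbT; split=> //.
by rewrite opprD addrACA subrr addr0 -mulrBr mulfK // subr_eq0 eq_sym.
Qed.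

Lemma alphas_cyclic : exists n ga gb, [/\ (0 < n)%N, inP h ga gb, ga ^+ n = 1 &
  forall al be, inP h al be -> exists2 i, (i < n)%N & al = ga ^+ i].
Proof.
have [als Uals alsP] := alphas_finite.
have als0 : 0 \notin als by apply/negP=> /alsP[be /andP[]]; rewrite eqxx.
have als1 : 1 \in als by apply/alsP; exists 0; apply: inP10.
have n0 : (0 < size als)%N by case: (als) als1.
have expn al : al \in als -> al ^+ size als = 1.
  move=> Pal; apply: stable_seq_exp1 => //.
    by apply: contraNneq als0 => <-.
  move: Pal => /alsP[be P] z /alsP[be' P']; apply/alsP.
  by exists (z * be + be'); apply: inP_comp.
(* [als] consists of as many distinct roots of unity as their common exponent, so one of them is
   primitive. *)
have /hasP[ga gals prim] : has (size als).-primitive_root als.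
  apply: has_prim_root => //; apply/allP=> al /expn E; exact/unity_rootP.
have [gb Pg] := (alsP ga).1 gals.
exists (size als), ga, gb; split=> //; first exact: expn.
move=> al be P; have /expn E : al \in als by apply/alsP; exists be.
by have [i ->] := prim_rootP prim E; exists i.
Qed.

Lemma alpha_order al be : inP h al be -> al != 1 ->
  al ^+ (size s).-1 = 1 \/ al ^+ size s = 1.
Proof.
move=> P al1; have [al0 _] := andP P.
have d0 : 1 - al != 0 by rewrite subr_eq0 eq_sym.
(* The fixed point of [al z + be]; moving it to 0 turns the map into multiplication by [al]. *)
pose mu := iota (be / (1 - al)).
have muE : iota be = mu - iota al * mu.
  by rewrite -{1}[mu]mul1r -mulrBl -[1](rmorph1 iota) -rmorphB -rmorphM mulrC divfK.
pose s' := [seq z - mu | z <- s & z != mu].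
have E : al ^+ size s' = 1.
  apply: (fmorph_inj iota); rewrite rmorphXn rmorph1.
  apply: stable_seq_exp1; first by rewrite map_inj_uniq ?filter_uniq //; apply: addIr.
  - apply/negP=> /mapP[z]; rewrite mem_filter => /andP[zmu _] /esym/eqP.
    by rewrite subr_eq0 (negPf zmu).
  - by rewrite fmorph_eq0.
  move=> _ /mapP[z zs ->]; apply/mapP; exists (iota al * z + iota be); last first.
    by rewrite muE mulrBr addrA [RHS]addrAC addrK.
  move: zs; rewrite !mem_filter inP_roots // => /andP[zmu ->]; rewrite andbT.
  apply: contra zmu; rewrite muE addrCA -subr_eq0 addrAC subrr add0r -mulrBr.
  by rewrite mulf_eq0 fmorph_eq0 (negPf al0) subr_eq0.
(* [s'] has [k - 1] elements if [mu] is a root and [k] otherwise. *)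
move: E; rewrite size_map; have [mus|mus] := boolP (mu \in s).
  by rewrite -rem_filter // size_rem // => ->; left.
rewrite (all_filterP _) => [->|]; first by right.
by apply/allP=> z zs /=; apply: contraNneq mus => <-.
Qed.

Lemma case_a_holds l : s = [:: iota l] -> case_a h l.
Proof.
move=> Es.
have inPE al be : inP h al be <-> al != 0 /\ be = (1 - al) * l.
  split=> [P|[al0 ->]]; last exact: single_inP.
  have [al0 _] := andP P; split=> //; apply: (fmorph_inj iota).
  by rewrite (inP_single Es P) rmorphM rmorphB rmorph1.
have P al : al != 0 -> inP h al ((1 - al) * l) by move=> al0; apply/inPE.
split; first exact: inPE.
- split=> [al al' al0 al'0|al al' _ _ E]; last by case: (tau_inj E).
  have <- : al' * ((1 - al) * l) + (1 - al') * l = (1 - al * al') * l.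
    by rewrite mulrA -mulrDl mulrBr mulr1 addrC subrKA [al' * al]mulrC.
  exact: (tau_comp sh (P _ al0) (P _ al'0)).
- split=> [t|f f' al al' al0 _ E]; last by case: (phi_tau_inj al0 E).
  split=> [/(Aut_factor sh)[f [al [be [Pal E]]]]|[f [al [al0 E]]]].
    have [al0 Ebe] := (inPE al be).1 Pal.
    by exists f, al; rewrite -Ebe.
  apply: is_Aut_ext E _; apply: is_Aut_comp; first exact: phi_Aut.
  by apply: tau_Aut => //; apply: P.
- exact: phi_comp.
move=> f al al0; have <- : al^-1 * ((1 - al) * l) = (al^-1 - 1) * l.
  by rewrite mulrA mulrBr mulr1 mulVf.
exact: (phi_tau sh f (P _ al0)).
Qed.

Lemma case_b_holds lam : s = [:: lam] -> (forall l : F, iota l != lam) -> case_b h.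
Proof.
move=> Es lamF; split.
- move=> t; split=> [/(Aut_factor sh)[f [al [be [P E]]]]|[f E]]; last first.
    by apply: is_Aut_ext E _; apply: phi_Aut.
  have al1 : al = 1.
    (* For [al] other than 1, the fixed point [be / (1 - al)] lies in [F] and its image is [lam]. *)
    apply/eqP/negPn/negP=> al1; have d0 : 1 - al != 0 by rewrite subr_eq0 eq_sym.
    have /negP := lamF (be / (1 - al)); apply; apply/eqP.
    rewrite fmorph_div (inP_single Es P) rmorphB rmorph1 mulrC mulKf //.
    by rewrite -[1](rmorph1 iota) -rmorphB fmorph_eq0.
  have be0 : be = 0.
    apply: (fmorph_inj iota).
    by rewrite (inP_single Es P) al1 rmorph1 subrr mul0r rmorph0.
  by exists f => x; rewrite E al1 be0 /= tau10.
- exact: phi_inj.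
- exact: phi_comp.
Qed.

Lemma case_k_holds : case_k h (size s).
Proof.
have [n [ga [gb [n0 Pg gn gen]]]] := alphas_cyclic.
have decomp al be : inP h al be -> exists nu i, [/\ inG h nu, (i < n)%N
    & tau h al be =1 tau h 1 nu \o fpow (tau h ga gb) i].
  (* A power of the generator has the same [al], so the two differ by a translation. *)
  move=> P; have [i lt_in Eal] := gen _ _ P; subst al.
  have [b [Pb Eb _]] := fpow_tau sh i Pg.
  have [nu Gnu Enu] := tau_split sh P Pb.
  by exists nu, i; split=> // x; rewrite Enu /= Eb.
split.
  exists n, ga, gb; split=> //.
  have [b [Pb Eb _]] := fpow_tau sh n Pg.
  by exists b; rewrite gn in Pb Eb.
case=> al [be [P neP]].
(* If the generator were 1, every [tau] would be a translation. *)
have ga1 : ga != 1.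
  apply/eqP=> ga1; case: neP; exists be; have [i _ Eal] := gen _ _ P.
  by rewrite Eal ga1 expr1n in P *.
have d0 : 1 - ga != 0 by rewrite subr_eq0 eq_sym.
have Emu : gb = (1 - ga) * (gb / (1 - ga)) by rewrite mulrC divfK.
have cycP c : in_cyc (tau h ga gb) c -> exists a b,
    [/\ inP h a b, c =1 tau h a b & a = 1 -> b = 0].
  case/(in_cyc_tau sh Pg Emu)=> a [b [Pab Ec Eb]]; exists a, b; split=> // a1.
  by rewrite Eb a1 subrr mul0r.
(* Comparing images of x gives [a = 1]. This settles the intersection with N, and with the
   translations on taking [f = 0]. *)
have cyc_trivial c f nu : in_cyc (tau h ga gb) c ->
    phi h f \o tau h 1 nu =1 c -> c =1 id.
  case/cycP=> a [b [_ Ec ab]] E.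
  have := E (Ax F); rewrite Ec /= !tau_Ax phi_C => /polyC_inj/aff_inj[/esym a1 _].
  by move=> x; rewrite Ec a1 (ab a1) tau10.
exists ga, gb; split; [exact: Pg|exact: ga1|exact: alpha_order Pg ga1| |].
  split; last by move=> nu Gnu; have [_] := tau_conj sh Pg Gnu.
  split=> [al' be' P'|nu c Gnu cc E].
    have [nu [i [Gnu _ E]]] := decomp _ _ P'.
    by exists nu, (fpow (tau h ga gb) i); split=> //; exists i; left.
  by apply: (cyc_trivial c 0 nu cc) => x; rewrite /= phi0 E.
split.
- move=> t; split=> [/(Aut_factor sh)[f [al' [be' [P' E]]]]|[f [nu [c [Gnu cc E]]]]].
    have [nu [i [Gnu _ E']]] := decomp _ _ P'.
    exists f, nu, (fpow (tau h ga gb) i); split=> //; first by exists i; left.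
    by move=> x; rewrite E /= E'.
  have [a [b [Pab Ec _]]] := cycP c cc.
  apply: is_Aut_ext E _; apply: is_Aut_comp.
    by apply: is_Aut_comp; [exact: phi_Aut | exact: tau_Aut].
  by apply: is_Aut_ext Ec _; apply: tau_Aut.
- move=> f nu Gnu; have [G' Ec] := tau_conj sh Pg Gnu.
  eexists; exists (ga * nu); split; first exact: G'.
  exact: comp_shift Ec (phi_tau sh f Pg).
- by move=> f nu c _; apply: cyc_trivial.
- by move=> f nu Gnu; eexists; exact: (phi_tau sh f Gnu).
move=> f nu _ E; have := E (Ax F); rewrite phi_C tau_Ax.
(* ['X] is read as the affine polynomial [1 x + 0], so that coefficients can be compared. *)
move=> /polyC_inj; rewrite -['X in LHS](_ : aff 1 0 = 'X); last first.
  by rewrite polyC0 mul1r addr0.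
by case/aff_inj=> _ nu0 x; rewrite E -nu0 tau10.
Qed.

End Roots.

Theorem theorem8p5 (F : fieldType) (L : closedFieldType)
    (iota : {rmorphism F -> L}) (h : {poly F}) (s : seq L) :
  (1 < size h)%N ->
  uniq s ->
  (forall z : L, root (map_poly iota h) z = (z \in s)) ->
  (size s = 1%N ->
     forall lam : L, s = [:: lam] ->
       (forall l : F, iota l = lam -> case_a h l) /\
       ((forall l : F, iota l != lam) -> case_b h)) /\
  ((2 <= size s)%N -> case_k h (size s)).
Proof.
move=> sh Us rs; split=> [_ lam Es|]; last exact: case_k_holds.
split=> [l El|]; last exact: case_b_holds Es.
by apply: (case_a_holds sh rs); rewrite El.
Qed.
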